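(* Let $\mathcal{B}$ be a pivotal bicategory. Then orbifold equivalence of objects of $\mathcal{B}$ is an equivalence relation.
   Context: In a bicategory $\mathcal{B}$, write $I_a$ for the unit 1-morphism of $a$, $Y\otimes X\in\mathcal{B}(a,c)$ for the composite of $X\in\mathcal{B}(a,b)$, $Y\in\mathcal{B}(b,c)$, and $\lambda,\rho$ for left and right unitors. $\mathcal{B}$ has left adjoints if every $X\in\mathcal{B}(a,b)$ has $X^\dagger\in\mathcal{B}(b,a)$ with 2-morphisms $\mathrm{ev}_X:X^\dagger\otimes X\to I_a$, $\mathrm{coev}_X:I_b\to X\otimes X^\dagger$ forming the counit and unit of an adjunction. It is pivotal if moreover there are natural isomorphisms $\delta^{a,b}:\mathrm{Id}\Rightarrow(-)^{\dagger\dagger}$ on each $\mathcal{B}(a,b)$, compatible with $\otimes$; then $\widetilde{\mathrm{ev}}_X=\mathrm{ev}_{X^\dagger}\circ(\delta_X\otimes1_{X^\dagger}):X\otimes X^\dagger\to I_b$ and $\widetilde{\mathrm{coev}}_X=(1_{X^\dagger}\otimes\delta_X^{-1})\circ\mathrm{coev}_{X^\dagger}:I_a\to X^\dagger\otimes X$. Define $\mathcal{D}_{\mathrm{l}}(X):\operatorname{End}(I_b)\to\operatorname{End}(I_a)$, $\varphi\mapsto\mathrm{ev}_X\circ[1_{X^\dagger}\otimes(\lambda_X\circ(\varphi\otimes1_X)\circ\lambda_X^{-1})]\circ\widetilde{\mathrm{coev}}_X$, and $\mathcal{D}_{\mathrm{r}}(X):\operatorname{End}(I_a)\to\operatorname{End}(I_b)$,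 $\psi\mapsto\widetilde{\mathrm{ev}}_X\circ[(\rho_X\circ(1_X\otimes\psi)\circ\rho_X^{-1})\otimes1_{X^\dagger}]\circ\mathrm{coev}_X$. The left and right quantum dimensions are $\dim_{\mathrm{l}}(X)=\mathcal{D}_{\mathrm{l}}(X)(1_{I_b})=\mathrm{ev}_X\circ\widetilde{\mathrm{coev}}_X$ and $\dim_{\mathrm{r}}(X)=\mathcal{D}_{\mathrm{r}}(X)(1_{I_a})=\widetilde{\mathrm{ev}}_X\circ\mathrm{coev}_X$. Objects $a,b$ are orbifold equivalent, $a\sim b$, if there is $X\in\mathcal{B}(a,b)$ such that (i) $\dim_{\mathrm{l}}(X)$ and $\dim_{\mathrm{r}}(X)$ are invertible, and (ii) $\mathcal{D}_{\mathrm{r}}(X)$ maps every invertible element of $\operatorname{End}(I_a)$ that is a (left or right) quantum dimension of some 1-morphism to an invertible element of $\operatorname{End}(I_b)$, and $\mathcal{D}_{\mathrm{l}}(X)$ maps every invertible element of $\operatorname{End}(I_b)$ that is a quantum dimension of some 1-morphism to an invertible element of $\operatorname{End}(I_a)$. *)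

(* Defs.v *)
From Stdlib Require Import RelationClasses.

Set Implicit Arguments.
Unset Strict Implicit.

Record PreBicat := {
  ob : Type;
  hom1 : ob -> ob -> Type;
  hom2 : forall a b : ob, hom1 a b -> hom1 a b -> Type;
  id1 : forall a : ob, hom1 a a;
  hc1 : forall a b c : ob, hom1 b c -> hom1 a b -> hom1 a c;
  id2 : forall a b (X : hom1 a b), hom2 X X;
  vc : forall a b (X Y Z : hom1 a b), hom2 Y Z -> hom2 X Y -> hom2 X Z;
  hc2 : forall a b c (Y Y' : hom1 b c) (X X' : hom1 a b),
      hom2 Y Y' -> hom2 X X' -> hom2 (hc1 Y X) (hc1 Y' X');
  assoc : forall a b c d (Z : hom1 c d) (Y : hom1 b c) (X : hom1 a b),
      hom2 (hc1 (hc1 Z Y) X) (hc1 Z (hc1 Y X));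
  assoc_inv : forall a b c d (Z : hom1 c d) (Y : hom1 b c) (X : hom1 a b),
      hom2 (hc1 Z (hc1 Y X)) (hc1 (hc1 Z Y) X);
  lunit : forall a b (X : hom1 a b), hom2 (hc1 (id1 b) X) X;
  lunit_inv : forall a b (X : hom1 a b), hom2 X (hc1 (id1 b) X);
  runit : forall a b (X : hom1 a b), hom2 (hc1 X (id1 a)) X;
  runit_inv : forall a b (X : hom1 a b), hom2 X (hc1 X (id1 a))
}.

Arguments ob : clear implicits.
Arguments hom1 {p} a b.
Arguments hom2 {p a b} X Y.
Arguments id1 {p} a.
Arguments hc1 {p a b c} Y X.
Arguments id2 {p a b} X.
Arguments vc {p a b X Y Z} g f.
Arguments hc2 {p a b c Y Y' X X'} g f.
Arguments assoc {p a b c d} Z Y X.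
Arguments assoc_inv {p a b c d} Z Y X.
Arguments lunit {p a b} X.
Arguments lunit_inv {p a b} X.
Arguments runit {p a b} X.
Arguments runit_inv {p a b} X.

Declare Scope bicat_scope.
Open Scope bicat_scope.
Notation "Y ⊗ X" := (hc1 Y X) (at level 40, left associativity) : bicat_scope.
Notation "g ∘ f" := (vc g f) (at level 45, left associativity) : bicat_scope.
Notation "g ⊙ f" := (hc2 g f) (at level 42, left associativity) : bicat_scope.

Record BicatLaws (B : PreBicat) : Prop := {
  vc_assoc : forall (a b : ob B) (W X Y Z : hom1 a b)
      (h : hom2 Y Z) (g : hom2 X Y) (f : hom2 W X), h ∘ (g ∘ f) = (h ∘ g) ∘ f;
  vc_id_l : forall (a b : ob B) (X Y : hom1 a b) (f : hom2 X Y), id2 Y ∘ f = f;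
  vc_id_r : forall (a b : ob B) (X Y : hom1 a b) (f : hom2 X Y), f ∘ id2 X = f;
  hc2_id : forall (a b c : ob B) (Y : hom1 b c) (X : hom1 a b), id2 Y ⊙ id2 X = id2 (Y ⊗ X);
  hc2_interchange : forall (a b c : ob B) (Y Y' Y'' : hom1 b c) (X X' X'' : hom1 a b)
      (g : hom2 Y Y') (g' : hom2 Y' Y'') (f : hom2 X X') (f' : hom2 X' X''),
      (g' ∘ g) ⊙ (f' ∘ f) = (g' ⊙ f') ∘ (g ⊙ f);
  assoc_nat : forall (a b c d : ob B) (Z Z' : hom1 c d) (Y Y' : hom1 b c) (X X' : hom1 a b)
      (h : hom2 Z Z') (g : hom2 Y Y') (f : hom2 X X'),
      assoc Z' Y' X' ∘ ((h ⊙ g) ⊙ f) = (h ⊙ (g ⊙ f)) ∘ assoc Z Y X;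
  assoc_inv_l : forall (a b c d : ob B) (Z : hom1 c d) (Y : hom1 b c) (X : hom1 a b),
      assoc_inv Z Y X ∘ assoc Z Y X = id2 ((Z ⊗ Y) ⊗ X);
  assoc_inv_r : forall (a b c d : ob B) (Z : hom1 c d) (Y : hom1 b c) (X : hom1 a b),
      assoc Z Y X ∘ assoc_inv Z Y X = id2 (Z ⊗ (Y ⊗ X));
  lunit_nat : forall (a b : ob B) (X X' : hom1 a b) (f : hom2 X X'),
      lunit X' ∘ (id2 (id1 b) ⊙ f) = f ∘ lunit X;
  lunit_inv_l : forall (a b : ob B) (X : hom1 a b), lunit_inv X ∘ lunit X = id2 (id1 b ⊗ X);
  lunit_inv_r : forall (a b : ob B) (X : hom1 a b), lunit X ∘ lunit_inv X = id2 X;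
  runit_nat : forall (a b : ob B) (X X' : hom1 a b) (f : hom2 X X'),
      runit X' ∘ (f ⊙ id2 (id1 a)) = f ∘ runit X;
  runit_inv_l : forall (a b : ob B) (X : hom1 a b), runit_inv X ∘ runit X = id2 (X ⊗ id1 a);
  runit_inv_r : forall (a b : ob B) (X : hom1 a b), runit X ∘ runit_inv X = id2 X;
  pentagon : forall (a b c d e : ob B) (W : hom1 d e) (Z : hom1 c d) (Y : hom1 b c) (X : hom1 a b),
      assoc W Z (Y ⊗ X) ∘ assoc (W ⊗ Z) Y X
      = (id2 W ⊙ assoc Z Y X) ∘ assoc W (Z ⊗ Y) X ∘ (assoc W Z Y ⊙ id2 X);
  triangle : forall (a b c : ob B) (Y : hom1 b c) (X : hom1 a b),
      (id2 Y ⊙ lunit X) ∘ assoc Y (id1 b) X = runit Y ⊙ id2 X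
}.

Record Bicat := { pre_bicat :> PreBicat; bicat_laws : BicatLaws pre_bicat }.

Record LeftAdjoints (B : Bicat) := {
  ldual : forall a b : ob B, hom1 a b -> hom1 b a;
  ev : forall a b (X : hom1 a b), hom2 (ldual X ⊗ X) (id1 a);
  coev : forall a b (X : hom1 a b), hom2 (id1 b) (X ⊗ ldual X);
  zigzag1 : forall a b (X : hom1 a b),
      runit X ∘ (id2 X ⊙ ev X) ∘ assoc X (ldual X) X ∘ (coev X ⊙ id2 X) ∘ lunit_inv X
      = id2 X;
  zigzag2 : forall a b (X : hom1 a b),
      lunit (ldual X) ∘ (ev X ⊙ id2 (ldual X)) ∘ assoc_inv (ldual X) X (ldual X)
        ∘ (id2 (ldual X) ⊙ coev X) ∘ runit_inv (ldual X)
      = id2 (ldual X)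
}.

Arguments ldual {B} _ {a b} X.
Arguments ev {B} _ {a b} X.
Arguments coev {B} _ {a b} X.

Section Duals.
Variables (B : Bicat) (L : LeftAdjoints B).

Definition dual2 {a b : ob B} {X Y : hom1 a b} (f : hom2 X Y)
  : hom2 (ldual L Y) (ldual L X) :=
  lunit (ldual L X) ∘ (ev L Y ⊙ id2 (ldual L X))
  ∘ assoc_inv (ldual L Y) Y (ldual L X)
  ∘ (id2 (ldual L Y) ⊙ (f ⊙ id2 (ldual L X)))
  ∘ (id2 (ldual L Y) ⊙ coev L X)
  ∘ runit_inv (ldual L Y).

Definition ev_comp {a b c : ob B} (Y : hom1 b c) (X : hom1 a b)
  : hom2 ((ldual L X ⊗ ldual L Y) ⊗ (Y ⊗ X)) (id1 a) :=
  ev L X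
  ∘ (id2 (ldual L X) ⊙ lunit X)
  ∘ (id2 (ldual L X) ⊙ (ev L Y ⊙ id2 X))
  ∘ (id2 (ldual L X) ⊙ assoc_inv (ldual L Y) Y X)
  ∘ assoc (ldual L X) (ldual L Y) (Y ⊗ X).

Definition dual_tensor {a b c : ob B} (Y : hom1 b c) (X : hom1 a b)
  : hom2 (ldual L X ⊗ ldual L Y) (ldual L (Y ⊗ X)) :=
  lunit (ldual L (Y ⊗ X))
  ∘ (ev_comp Y X ⊙ id2 (ldual L (Y ⊗ X)))
  ∘ assoc_inv (ldual L X ⊗ ldual L Y) (Y ⊗ X) (ldual L (Y ⊗ X))
  ∘ (id2 (ldual L X ⊗ ldual L Y) ⊙ coev L (Y ⊗ X))
  ∘ runit_inv (ldual L X ⊗ ldual L Y).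

End Duals.

Record Pivotal (B : Bicat) (L : LeftAdjoints B) := {
  delta : forall a b (X : hom1 a b), hom2 X (ldual L (ldual L X));
  delta_inv : forall a b (X : hom1 a b), hom2 (ldual L (ldual L X)) X;
  delta_inv_l : forall a b (X : hom1 a b), delta_inv X ∘ delta X = id2 X;
  delta_inv_r : forall a b (X : hom1 a b),
      delta X ∘ delta_inv X = id2 (ldual L (ldual L X));
  delta_nat : forall a b (X Y : hom1 a b) (f : hom2 X Y),
      delta Y ∘ f = dual2 L (dual2 L f) ∘ delta X;
  (* compatibility with ⊗: under the canonical isomorphism
     (Y ⊗ X)^{††} ≅ Y^{††} ⊗ X^{††}, delta_{Y⊗X} = delta_Y ⊗ delta_X *)
  delta_tensor : forall a b c (Y : hom1 b c) (X : hom1 a b),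
      dual_tensor L (ldual L X) (ldual L Y) ∘ (delta Y ⊙ delta X)
      = dual2 L (dual_tensor L Y X) ∘ delta (Y ⊗ X)
}.

Arguments delta {B L} _ {a b} X.
Arguments delta_inv {B L} _ {a b} X.

Section QDim.
Variables (B : Bicat) (L : LeftAdjoints B) (P : Pivotal L).

Definition End1 (a : ob B) : Type := hom2 (id1 a) (id1 a).

Definition invertible2 {a b : ob B} {X Y : hom1 a b} (f : hom2 X Y) : Prop :=
  exists g : hom2 Y X, g ∘ f = id2 X /\ f ∘ g = id2 Y.

Definition tev {a b : ob B} (X : hom1 a b) : hom2 (X ⊗ ldual L X) (id1 b) :=
  ev L (ldual L X) ∘ (delta P X ⊙ id2 (ldual L X)).

Definition tcoev {a b : ob B} (X : hom1 a b) : hom2 (id1 a) (ldual L X ⊗ X) :=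
  (id2 (ldual L X) ⊙ delta_inv P X) ∘ coev L (ldual L X).

Definition Dl {a b : ob B} (X : hom1 a b) (phi : End1 b) : End1 a :=
  ev L X ∘ (id2 (ldual L X) ⊙ (lunit X ∘ (phi ⊙ id2 X) ∘ lunit_inv X)) ∘ tcoev X.

Definition Dr {a b : ob B} (X : hom1 a b) (psi : End1 a) : End1 b :=
  tev X ∘ ((runit X ∘ (id2 X ⊙ psi) ∘ runit_inv X) ⊙ id2 (ldual L X)) ∘ coev L X.

Definition dim_l {a b : ob B} (X : hom1 a b) : End1 a := ev L X ∘ tcoev X.
Definition dim_r {a b : ob B} (X : hom1 a b) : End1 b := tev X ∘ coev L X.

Definition is_qdim {a : ob B} (psi : End1 a) : Prop :=
  (exists (c : ob B) (Z : hom1 a c), dim_l Z = psi)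
  \/ (exists (c : ob B) (Z : hom1 c a), dim_r Z = psi).

Definition orbifold_equivalent (a b : ob B) : Prop :=
  exists X : hom1 a b,
    invertible2 (dim_l X) /\ invertible2 (dim_r X)
    /\ (forall psi : End1 a, invertible2 psi -> is_qdim psi -> invertible2 (Dr X psi))
    /\ (forall phi : End1 b, invertible2 phi -> is_qdim phi -> invertible2 (Dl X phi)).

End QDim.

Arguments orbifold_equivalent {B L} P a b.

(* Main.v *)
Require Import Defs.
From Stdlib Require Import RelationClasses.

(** A 1-morphism [X : a -> b] is studied through the functors [X ⊗ -] on the categories of
    1-morphisms into [a] and [b].  There [X† ⊗ -] is left adjoint to [X ⊗ -], and an
    endomorphism [phi] of a unit acts by [act phi W]; this action is faithful, since it returns
    [phi] when [W] is the unit.  So identities between elements of [End1] can be checked on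
    actions, where whiskering is strict and the associators mostly disappear.

    Write [t_X : X ⊗ X† -> 1] for the pairing [tev P X].  It is dinatural in [X], and nested
    pairings compute [t_(Y ⊗ X)] because [delta] is compatible with [⊗].  Hence
    [Dr (Y ⊗ X) = Dr Y ∘ Dr X], and [Dr] depends only on the isomorphism class of [X].
    Applied to [1 ⊗ 1 ≅ 1] this makes [dim_r 1] idempotent, and it is invertible, so it is [1].
    Dinaturality of [t] along [ev_X : X† ⊗ X -> 1] then gives [t_(X†) ∘ (1 ⊗ delta_X) = ev_X],
    that is [Dl X = Dr X†].  So [Dl] is multiplicative too, every quantum dimension is a right
    one, and [Dr], [Dl] preserve quantum dimensions.  Orbifold equivalence is therefore
    witnessed by [1], [X†] and [Y ⊗ X] respectively. *)

Set Implicit Arguments.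
Unset Strict Implicit.

Notation "X ◁ g" := (id2 X ⊙ g) (at level 41, right associativity) : bicat_scope.
Notation "f ▷ W" := (f ⊙ id2 W) (at level 42, left associativity) : bicat_scope.

(** * Vertical composition *)

Section Bicategory.
Context {B : Bicat}.
Implicit Types a b c : ob B.

Lemma vcA a b (W X Y Z : hom1 a b) (h : hom2 Y Z) (g : hom2 X Y) (f : hom2 W X) :
  h ∘ (g ∘ f) = h ∘ g ∘ f.
Proof. exact (vc_assoc (bicat_laws B) h g f). Qed.

Lemma vc1l a b (X Y : hom1 a b) (f : hom2 X Y) : id2 Y ∘ f = f.
Proof. exact (vc_id_l (bicat_laws B) f). Qed.

Lemma vc1r a b (X Y : hom1 a b) (f : hom2 X Y) : f ∘ id2 X = f.
Proof. exact (vc_id_r (bicat_laws B) f). Qed.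

Lemma hc2_11 a b c (Y : hom1 b c) (X : hom1 a b) : id2 Y ⊙ id2 X = id2 (Y ⊗ X).
Proof. exact (hc2_id (bicat_laws B) Y X). Qed.

(** In the left-nested [k ∘ g ∘ f] the composite [g ∘ f] is not a subterm; this lemma and the next
    two let an equation act behind a prefix [k]. *)
Lemma post2 a b (V W X Y : hom1 a b) (g : hom2 W X) (f : hom2 V W) h (k : hom2 X Y) :
  g ∘ f = h -> k ∘ g ∘ f = k ∘ h.
Proof. intros <-. now rewrite vcA. Qed.

Lemma post3 a b (U V W X Y : hom1 a b) (g : hom2 W X) (f : hom2 V W) (e : hom2 U V) h
    (k : hom2 X Y) :
  g ∘ f ∘ e = h -> k ∘ g ∘ f ∘ e = k ∘ h.
Proof. intros <-. now rewrite ?vcA. Qed.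

Lemma post4 a b (T U V W X Y : hom1 a b) (g : hom2 W X) (f : hom2 V W) (e : hom2 U V)
    (d : hom2 T U) h (k : hom2 X Y) :
  g ∘ f ∘ e ∘ d = h -> k ∘ g ∘ f ∘ e ∘ d = k ∘ h.
Proof. intros <-. now rewrite ?vcA. Qed.

End Bicategory.

(* Rewriting modulo associativity of [∘], on composites kept in left-associated form; [E] may
   have a composite of up to four factors on the side being replaced. *)
Tactic Notation "rw" uconstr(E) :=
  first [ rewrite E | rewrite (post2 _ E) | rewrite (post3 _ E) | rewrite (post4 _ E) ];
  rewrite ?hc2_11, ?vcA, ?vc1l, ?vc1r.
Tactic Notation "rw" "<-" uconstr(E) :=
  first [ rewrite <- E | rewrite (post2 _ (eq_sym E)) | rewrite (post3 _ (eq_sym E))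
        | rewrite (post4 _ (eq_sym E)) ];
  rewrite ?hc2_11, ?vcA, ?vc1l, ?vc1r.

(** * Coherence *)

Section Coherence.
Context {B : Bicat}.
Implicit Types a b c d e z : ob B.

Lemma whisker_l_vc a b c (Y : hom1 b c) (U V W : hom1 a b) (g : hom2 V W) (f : hom2 U V) :
  Y ◁ (g ∘ f) = (Y ◁ g) ∘ (Y ◁ f).
Proof. now rewrite <- (hc2_interchange (bicat_laws B)), vc1l. Qed.

Lemma whisker_r_vc a b c (U V W : hom1 b c) (X : hom1 a b) (g : hom2 V W) (f : hom2 U V) :
  (g ∘ f) ▷ X = (g ▷ X) ∘ (f ▷ X).
Proof. now rewrite <- (hc2_interchange (bicat_laws B)), vc1l. Qed.

Lemma hc2_split a b c (Y Y' : hom1 b c) (X X' : hom1 a b) (g : hom2 Y Y') (f : hom2 X X') :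
  g ⊙ f = (Y' ◁ f) ∘ (g ▷ X).
Proof. now rewrite <- (hc2_interchange (bicat_laws B)), vc1l, vc1r. Qed.

Lemma whisker_exchange a b c (Y Y' : hom1 b c) (X X' : hom1 a b) (g : hom2 Y Y')
    (f : hom2 X X') :
  (g ▷ X') ∘ (Y ◁ f) = (Y' ◁ f) ∘ (g ▷ X).
Proof. now rewrite <- !(hc2_interchange (bicat_laws B)), !vc1l, !vc1r. Qed.

Lemma assocK a b c d (Z : hom1 c d) (Y : hom1 b c) (X : hom1 a b) :
  assoc_inv Z Y X ∘ assoc Z Y X = id2 _.
Proof. exact (assoc_inv_l (bicat_laws B) Z Y X). Qed.

Lemma assocVK a b c d (Z : hom1 c d) (Y : hom1 b c) (X : hom1 a b) :
  assoc Z Y X ∘ assoc_inv Z Y X = id2 _.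
Proof. exact (assoc_inv_r (bicat_laws B) Z Y X). Qed.

Lemma lunitK a b (X : hom1 a b) : lunit_inv X ∘ lunit X = id2 _.
Proof. exact (lunit_inv_l (bicat_laws B) X). Qed.

Lemma lunitVK a b (X : hom1 a b) : lunit X ∘ lunit_inv X = id2 _.
Proof. exact (lunit_inv_r (bicat_laws B) X). Qed.

Lemma runitK a b (X : hom1 a b) : runit_inv X ∘ runit X = id2 _.
Proof. exact (runit_inv_l (bicat_laws B) X). Qed.

Lemma runitVK a b (X : hom1 a b) : runit X ∘ runit_inv X = id2 _.
Proof. exact (runit_inv_r (bicat_laws B) X). Qed.

Lemma assoc_inv_nat a b c d (Z Z' : hom1 c d) (Y Y' : hom1 b c) (X X' : hom1 a b)
    (h : hom2 Z Z') (g : hom2 Y Y') (f : hom2 X X') :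
  assoc_inv Z' Y' X' ∘ (h ⊙ (g ⊙ f)) = ((h ⊙ g) ⊙ f) ∘ assoc_inv Z Y X.
Proof.
rewrite <- (vc1r (_ ∘ (_ ⊙ (_ ⊙ _)))), <- assocVK, ?vcA.
rw <- (assoc_nat (bicat_laws B) _ _ _).
rw (assocK _ _ _). reflexivity.
Qed.

Lemma assoc_whisker_l a b c d (Z : hom1 c d) (Y : hom1 b c) (X X' : hom1 a b)
    (f : hom2 X X') :
  assoc Z Y X' ∘ (Z ⊗ Y ◁ f) = (Z ◁ Y ◁ f) ∘ assoc Z Y X.
Proof. now rewrite <- (assoc_nat (bicat_laws B)), hc2_11. Qed.

Lemma assoc_whisker_m a b c d (Z : hom1 c d) (Y Y' : hom1 b c) (X : hom1 a b)
    (g : hom2 Y Y') :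
  assoc Z Y' X ∘ ((Z ◁ g) ▷ X) = (Z ◁ (g ▷ X)) ∘ assoc Z Y X.
Proof. now rewrite <- (assoc_nat (bicat_laws B)). Qed.

Lemma assoc_whisker_r a b c d (Z Z' : hom1 c d) (Y : hom1 b c) (X : hom1 a b)
    (h : hom2 Z Z') :
  assoc Z' Y X ∘ (h ▷ Y ▷ X) = (h ▷ (Y ⊗ X)) ∘ assoc Z Y X.
Proof. now rewrite (assoc_nat (bicat_laws B)), hc2_11. Qed.

Lemma assoc_inv_whisker_l a b c d (Z : hom1 c d) (Y : hom1 b c) (X X' : hom1 a b)
    (f : hom2 X X') :
  assoc_inv Z Y X' ∘ (Z ◁ Y ◁ f) = (Z ⊗ Y ◁ f) ∘ assoc_inv Z Y X.
Proof. now rewrite assoc_inv_nat, hc2_11. Qed.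

Lemma assoc_inv_whisker_m a b c d (Z : hom1 c d) (Y Y' : hom1 b c) (X : hom1 a b)
    (g : hom2 Y Y') :
  assoc_inv Z Y' X ∘ (Z ◁ (g ▷ X)) = ((Z ◁ g) ▷ X) ∘ assoc_inv Z Y X.
Proof. apply assoc_inv_nat. Qed.

Lemma assoc_inv_whisker_r a b c d (Z Z' : hom1 c d) (Y : hom1 b c) (X : hom1 a b)
    (h : hom2 Z Z') :
  assoc_inv Z' Y X ∘ (h ▷ (Y ⊗ X)) = (h ▷ Y ▷ X) ∘ assoc_inv Z Y X.
Proof. now rewrite <- assoc_inv_nat, hc2_11. Qed.

Lemma lunit_inv_nat a b (X X' : hom1 a b) (f : hom2 X X') :
  (id1 b ◁ f) ∘ lunit_inv X = lunit_inv X' ∘ f.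
Proof.
rewrite <- (vc1l (_ ∘ lunit_inv X)), <- lunitK, ?vcA.
rw (lunit_nat (bicat_laws B) f). rw (lunitVK X). reflexivity.
Qed.

Lemma runit_inv_nat a b (X X' : hom1 a b) (f : hom2 X X') :
  (f ▷ id1 a) ∘ runit_inv X = runit_inv X' ∘ f.
Proof.
rewrite <- (vc1l (_ ∘ runit_inv X)), <- runitK, ?vcA.
rw (runit_nat (bicat_laws B) f). rw (runitVK X). reflexivity.
Qed.

Lemma vc_cancel_r a b (X Y Z : hom1 a b) (g g' : hom2 Y Z) (f : hom2 X Y) f' :
  f ∘ f' = id2 Y -> g ∘ f = g' ∘ f -> g = g'.
Proof.
intros K E. now rewrite <- (vc1r g), <- (vc1r g'), <- K, ?vcA, E.
Qed.

Lemma vc_cancel_l a b (X Y Z : hom1 a b) (g g' : hom2 X Y) (f : hom2 Y Z) f' :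
  f' ∘ f = id2 Y -> f ∘ g = f ∘ g' -> g = g'.
Proof.
intros K E. now rewrite <- (vc1l g), <- (vc1l g'), <- K, <- ?vcA, E.
Qed.

(** By naturality of the invertible [lunit], whiskering with a unit is isomorphic to the identity
    functor, hence faithful. *)
Lemma id_whisker_inj a b (X Y : hom1 a b) (f g : hom2 X Y) :
  id1 b ◁ f = id1 b ◁ g -> f = g.
Proof.
intros E. apply (vc_cancel_r (lunitVK X)).
now rewrite <- !(lunit_nat (bicat_laws B)), E.
Qed.

Lemma whisker_id_inj a b (X Y : hom1 a b) (f g : hom2 X Y) :
  f ▷ id1 a = g ▷ id1 a -> f = g.
Proof.
intros E. apply (vc_cancel_r (runitVK X)).
now rewrite <- !(runit_nat (bicat_laws B)), E.
Qed.

Lemma pentagon_V a b c d e (W : hom1 d e) (Z : hom1 c d) (Y : hom1 b c) (X : hom1 a b) :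
  assoc (W ⊗ Z) Y X ∘ (assoc_inv W Z Y ▷ X)
  = assoc_inv W Z (Y ⊗ X) ∘ (W ◁ assoc Z Y X) ∘ assoc W (Z ⊗ Y) X.
Proof.
apply (vc_cancel_l (assocK W Z (Y ⊗ X))). rewrite ?vcA.
rw (pentagon (bicat_laws B) W Z Y X).
rw (assocVK _ _ _). rw <- (whisker_r_vc _ _ _). rw (assocVK _ _ _). reflexivity.
Qed.

(* Kelly's argument: whisker by the identity on the left, where the triangle identity applies. *)
Lemma lunit_tensor a b c (Y : hom1 b c) (X : hom1 a b) :
  lunit (Y ⊗ X) ∘ assoc (id1 c) Y X = lunit Y ▷ X.
Proof.
apply id_whisker_inj. rewrite whisker_l_vc.
assert (K : assoc (id1 c) (id1 c ⊗ Y) X ∘ (assoc (id1 c) (id1 c) Y ▷ X)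
   ∘ ((assoc_inv (id1 c) (id1 c) Y ▷ X) ∘ assoc_inv (id1 c) (id1 c ⊗ Y) X) = id2 _).
{ rewrite ?vcA. rw <- (whisker_r_vc _ _ _). rw (assocVK _ _ _). apply assocVK. }
apply (vc_cancel_r K). rewrite ?vcA.
rw <- (pentagon (bicat_laws B) _ _ _ _).
rw (triangle (bicat_laws B) _ _).
rw <- (assoc_whisker_m _ _ _). rw <- (whisker_r_vc _ _ _).
rewrite (triangle (bicat_laws B)). rewrite assoc_whisker_r. reflexivity.
Qed.

(** Whiskered by the unit on the right, the claim becomes [lunit (1 ⊗ 1) = 1 ◁ lunit 1], which
    follows from naturality of [lunit] at [lunit 1]. *)
Lemma lunit_id1 a : lunit (id1 a) = runit (id1 a).
Proof.
apply whisker_id_inj. rewrite <- (triangle (bicat_laws B)), <- lunit_tensor.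
f_equal. apply (vc_cancel_l (lunitK (id1 a))).
symmetry. apply (lunit_nat (bicat_laws B)).
Qed.

Lemma lunit_tensor_V a b c (Y : hom1 b c) (X : hom1 a b) :
  assoc (id1 c) Y X ∘ (lunit_inv Y ▷ X) = lunit_inv (Y ⊗ X).
Proof.
apply (vc_cancel_l (lunitK (Y ⊗ X))). rewrite vcA, lunit_tensor, <- whisker_r_vc.
now rewrite !lunitVK, hc2_11.
Qed.

Lemma triangle_V a b c (Y : hom1 b c) (X : hom1 a b) :
  assoc Y (id1 b) X ∘ (runit_inv Y ▷ X) = Y ◁ lunit_inv X.
Proof.
apply (vc_cancel_l (f := Y ◁ lunit X) (f' := Y ◁ lunit_inv X)).
- now rewrite <- whisker_l_vc, lunitK, hc2_11.
- rewrite vcA, (triangle (bicat_laws B)), <- whisker_r_vc, <- whisker_l_vc.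
  now rewrite runitVK, lunitVK, !hc2_11.
Qed.

(** The transformation from [A ⊗ (C ⊗ -)] to the identity induced by a pairing [p]. No adjunction is
    assumed, so it serves [ev], [tev] and [ev_comp] alike. *)
Definition contract a b c (A : hom1 b c) (C : hom1 c b) (p : hom2 (A ⊗ C) (id1 c))
    (X : hom1 a c) : hom2 (A ⊗ (C ⊗ X)) X :=
  lunit X ∘ (p ▷ X) ∘ assoc_inv A C X.

Lemma contract_nat a b c (A : hom1 b c) (C : hom1 c b) (p : hom2 (A ⊗ C) (id1 c))
    (X X' : hom1 a c) (f : hom2 X X') :
  contract p X' ∘ (A ◁ C ◁ f) = f ∘ contract p X.
Proof.
unfold contract. rw (assoc_inv_whisker_l _ _ _). rw (whisker_exchange _ _).
rw (lunit_nat (bicat_laws B) _). reflexivity.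
Qed.

Lemma contract_tensor a b c z (A : hom1 b c) (C : hom1 c b) (p : hom2 (A ⊗ C) (id1 c))
    (X : hom1 a c) (V : hom1 z a) :
  (contract p X ▷ V)
  = contract p (X ⊗ V) ∘ (A ◁ assoc C X V) ∘ assoc A (C ⊗ X) V.
Proof.
unfold contract. rewrite !whisker_r_vc, <- lunit_tensor.
rw (assoc_whisker_r _ _ _). rw (pentagon_V _ _ _ _). reflexivity.
Qed.

Lemma contract_vc_whisker a b c (A : hom1 b c) (C C' : hom1 c b) (p : hom2 (A ⊗ C') (id1 c))
    (f : hom2 C C') (X : hom1 a c) :
  contract (p ∘ (A ◁ f)) X = contract p X ∘ (A ◁ (f ▷ X)).
Proof.
unfold contract. rewrite whisker_r_vc, ?vcA. rw (assoc_inv_whisker_m _ _ _). reflexivity.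
Qed.

Lemma contract_whisker_vc a b c (A A' : hom1 b c) (C : hom1 c b) (p : hom2 (A' ⊗ C) (id1 c))
    (f : hom2 A A') (X : hom1 a c) :
  contract (p ∘ (f ▷ C)) X = contract p X ∘ (f ▷ (C ⊗ X)).
Proof.
unfold contract. rewrite whisker_r_vc, ?vcA. rw (assoc_inv_whisker_r _ _ _). reflexivity.
Qed.

Lemma contract_assoc a b c d (A : hom1 b c) (A' : hom1 d b) (C : hom1 c d)
    (p : hom2 (A ⊗ (A' ⊗ C)) (id1 c)) (X : hom1 a c) :
  contract (p ∘ assoc A A' C) X
  = contract p X ∘ (A ◁ assoc_inv A' C X) ∘ assoc A A' (C ⊗ X).
Proof.
unfold contract. rewrite whisker_r_vc, ?vcA.
apply (vc_cancel_r (assocVK (A ⊗ A') C X)). rewrite ?vcA.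
rw (assocK _ _ _).
rw (pentagon (bicat_laws B) _ _ _ _).
rw <- (whisker_l_vc _ _ _). rw (assocK _ _ _). rw (assocK _ _ _). reflexivity.
Qed.

End Coherence.

(** * Actions of endomorphisms of the unit *)

Section Actions.
Context {B : Bicat}.
Implicit Types a b c z : ob B.

Definition cocontract a b c (A : hom1 b c) (C : hom1 c b) (q : hom2 (id1 c) (A ⊗ C))
    (X : hom1 a c) : hom2 X (A ⊗ (C ⊗ X)) :=
  assoc A C X ∘ (q ▷ X) ∘ lunit_inv X.

Lemma cocontract_nat a b c (A : hom1 b c) (C : hom1 c b) (q : hom2 (id1 c) (A ⊗ C))
    (X X' : hom1 a c) (f : hom2 X X') :
  (A ◁ C ◁ f) ∘ cocontract q X = cocontract q X' ∘ f.
Proof.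
unfold cocontract. rewrite ?vcA. rw <- (lunit_inv_nat f). rw (whisker_exchange _ _).
rw (assoc_whisker_l _ _ _). reflexivity.
Qed.

Lemma cocontract_whisker_l a b c (A : hom1 b c) (C C' : hom1 c b)
    (q : hom2 (id1 c) (A ⊗ C)) (f : hom2 C C') (X : hom1 a c) :
  cocontract ((A ◁ f) ∘ q) X = (A ◁ (f ▷ X)) ∘ cocontract q X.
Proof.
unfold cocontract. rewrite whisker_r_vc, ?vcA. now rewrite assoc_whisker_m.
Qed.

Lemma cocontract_whisker_r a b c (A A' : hom1 b c) (C : hom1 c b)
    (q : hom2 (id1 c) (A ⊗ C)) (f : hom2 A A') (X : hom1 a c) :
  cocontract ((f ▷ C) ∘ q) X = (f ▷ (C ⊗ X)) ∘ cocontract q X.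
Proof.
unfold cocontract. rewrite whisker_r_vc, ?vcA. now rewrite assoc_whisker_r.
Qed.

Definition act a b (phi : End1 b) (X : hom1 a b) : hom2 X X :=
  lunit X ∘ (phi ▷ X) ∘ lunit_inv X.

Lemma act_nat a b (phi : End1 b) (X Y : hom1 a b) (f : hom2 X Y) :
  act phi Y ∘ f = f ∘ act phi X.
Proof.
unfold act. rw <- (lunit_inv_nat f). rw (whisker_exchange _ _).
rw (lunit_nat (bicat_laws B) f). reflexivity.
Qed.

Lemma act_id a b (X : hom1 a b) : act (id2 (id1 b)) X = id2 X.
Proof. unfold act. rewrite hc2_11, vc1r. apply lunitVK. Qed.

Lemma act_vc a b (phi psi : End1 b) (X : hom1 a b) :
  act (phi ∘ psi) X = act phi X ∘ act psi X.
Proof. unfold act. rewrite whisker_r_vc, ?vcA. rw (lunitK X). reflexivity. Qed.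

(** Since [lunit] and [runit] agree on the unit, naturality of [runit] pulls [phi] out. *)
Lemma act_id1 a (phi : End1 a) : act phi (id1 a) = phi.
Proof.
unfold act. rewrite lunit_id1, (runit_nat (bicat_laws B)), <- lunit_id1.
now rewrite <- vcA, lunitVK, vc1r.
Qed.

Lemma act_inj b (phi psi : End1 b) :
  (forall X : hom1 b b, act phi X = act psi X) -> phi = psi.
Proof. intros E. now rewrite <- (act_id1 phi), E, act_id1. Qed.

Lemma act_tensor a b z (phi : End1 b) (X : hom1 a b) (V : hom1 z a) :
  act phi X ▷ V = act phi (X ⊗ V).
Proof.
unfold act. rewrite !whisker_r_vc, <- lunit_tensor, <- lunit_tensor_V, ?vcA.
rw (assoc_whisker_r _ _ _). reflexivity.
Qed.

(** The bracket is the right-hand action of [psi] on [X] found in [Dr]; the triangle identities move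
    it across to [V]. *)
Lemma act_whisker_l a b z (psi : End1 a) (X : hom1 a b) (V : hom1 z a) :
  (runit X ∘ (X ◁ psi) ∘ runit_inv X) ▷ V = X ◁ act psi V.
Proof.
unfold act. rewrite !whisker_r_vc, !whisker_l_vc, <- (triangle (bicat_laws B)), <- triangle_V,
  ?vcA.
rw (assoc_whisker_m _ _ _). reflexivity.
Qed.

Lemma act_loop a b c (A : hom1 b c) (C : hom1 c b) (p : hom2 (A ⊗ C) (id1 c))
    (q : hom2 (id1 c) (A ⊗ C)) (X : hom1 a c) :
  act (p ∘ q) X = contract p X ∘ cocontract q X.
Proof.
unfold act, contract, cocontract. rewrite whisker_r_vc, ?vcA. rw (assocK _ _ _). reflexivity.
Qed.

End Actions.

(** * Adjunctions acting by composition *)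

Section Adjoints.
Context {B : Bicat} (L : LeftAdjoints B).
Implicit Types a b c z : ob B.
Local Notation "X †" := (ldual L X) (at level 1, format "X †").

(** Together with [eta], the counit and unit of the adjunction [X† ⊗ -] ⊣ [X ⊗ -]. *)
Definition eps a b z (X : hom1 a b) (W : hom1 z a) : hom2 (X† ⊗ (X ⊗ W)) W :=
  contract (ev L X) W.

Definition eta a b z (X : hom1 a b) (W : hom1 z b) : hom2 W (X ⊗ (X† ⊗ W)) :=
  cocontract (coev L X) W.

Lemma eps_nat a b z (X : hom1 a b) (V W : hom1 z a) (f : hom2 V W) :
  eps X W ∘ (X† ◁ X ◁ f) = f ∘ eps X V.
Proof. apply contract_nat. Qed.

Lemma eta_nat a b z (X : hom1 a b) (V W : hom1 z b) (f : hom2 V W) :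
  (X ◁ X† ◁ f) ∘ eta X V = eta X W ∘ f.
Proof. apply cocontract_nat. Qed.

(* The 2-morphism [A -> X†] that corresponds to [p] under [A ⊗ X -> 1]; both [dual2] and
   [dual_tensor] are of this form. *)
Definition mate a b (A : hom1 b a) (X : hom1 a b) (p : hom2 (A ⊗ X) (id1 a)) : hom2 A X† :=
  contract p X† ∘ (A ◁ coev L X) ∘ runit_inv A.

Lemma mate_whisker a b z (A : hom1 b a) (X : hom1 a b) (p : hom2 (A ⊗ X) (id1 a))
    (W : hom1 z b) :
  mate p ▷ W = contract p (X† ⊗ W) ∘ (A ◁ eta X W).
Proof.
unfold mate, eta, cocontract. rewrite !whisker_r_vc, !whisker_l_vc, contract_tensor, ?vcA.
rw (assoc_whisker_m _ _ _). rw (triangle_V _ _). reflexivity.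
Qed.

(** By [zigzag2] the mate of [ev L X] is the identity, so [mate_whisker] becomes a triangle
    identity. *)
Lemma eps_eta a b z (X : hom1 a b) (W : hom1 z b) :
  eps X (X† ⊗ W) ∘ (X† ◁ eta X W) = id2 (X† ⊗ W).
Proof.
unfold eps. rewrite <- mate_whisker.
replace (mate (ev L X)) with (id2 X†); [apply hc2_11 |].
symmetry. unfold mate, contract. rewrite ?vcA. apply zigzag2.
Qed.

Lemma eta_eps a b z (X : hom1 a b) (W : hom1 z a) :
  (X ◁ eps X W) ∘ eta X (X ⊗ W) = id2 (X ⊗ W).
Proof.
pose proof (f_equal (fun g => g ▷ W) (zigzag1 L X)) as E. cbv beta in E.
rewrite hc2_11 in E. rewrite <- E.
unfold eps, eta, contract, cocontract.
rewrite !whisker_r_vc, !whisker_l_vc, <- (triangle (bicat_laws B)), <- lunit_tensor_V, ?vcA.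
rw <- (assoc_whisker_r _ _ _).
rw (assoc_whisker_m _ _ _).
apply (f_equal (fun g => g ∘ _)). apply (f_equal (fun g => g ∘ _)).
rw (pentagon (bicat_laws B) _ _ _ _).
rw <- (whisker_l_vc _ (assoc_inv _ _ _) _). rw (assocK _ _ _). reflexivity.
Qed.

(** With [transposeVK]: transposition is a bijection between 2-morphisms [X† ⊗ V -> W] and
    [V -> X ⊗ W]. *)
Lemma transposeK a b z (X : hom1 a b) (V : hom1 z b) (W : hom1 z a) (g : hom2 V (X ⊗ W)) :
  (X ◁ (eps X W ∘ (X† ◁ g))) ∘ eta X V = g.
Proof. rw (whisker_l_vc _ _ _). rw (eta_nat _ _). rw (eta_eps _ _). reflexivity. Qed.

Lemma transposeVK a b z (X : hom1 a b) (V : hom1 z b) (W : hom1 z a) (g : hom2 (X† ⊗ V) W) :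
  eps X W ∘ (X† ◁ ((X ◁ g) ∘ eta X V)) = g.
Proof. rw (whisker_l_vc _ _ _). rw (eps_nat _ _). rw (eps_eta _ _). reflexivity. Qed.

Lemma eps_mate a b z (A : hom1 b a) (X : hom1 a b) (p : hom2 (A ⊗ X) (id1 a))
    (W : hom1 z a) :
  eps X W ∘ (mate p ▷ (X ⊗ W)) = contract p W.
Proof.
rewrite mate_whisker, ?vcA. rw <- (contract_nat p (eps X W)).
rw <- (whisker_l_vc _ _ (eta _ _)). rw (eta_eps _ _). reflexivity.
Qed.

Lemma dual2_mate a b (X Y : hom1 a b) (f : hom2 X Y) :
  dual2 L f = mate (ev L Y ∘ (Y† ◁ f)).
Proof. unfold mate. rewrite contract_vc_whisker. reflexivity. Qed.

Lemma dual2_whisker a b z (X Y : hom1 a b) (f : hom2 X Y) (W : hom1 z b) :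
  dual2 L f ▷ W
  = eps Y (X† ⊗ W) ∘ (Y† ◁ ((f ▷ (X† ⊗ W)) ∘ eta X W)).
Proof.
rewrite dual2_mate, mate_whisker, contract_vc_whisker, whisker_l_vc, ?vcA. reflexivity.
Qed.

(** Dinaturality of the counit; [eta_dual2] is its counterpart for the unit. *)
Lemma eps_dual2 a b z (X Y : hom1 a b) (f : hom2 X Y) (W : hom1 z a) :
  eps X W ∘ (dual2 L f ▷ (X ⊗ W)) = eps Y W ∘ (Y† ◁ (f ▷ W)).
Proof.
now rewrite dual2_mate, eps_mate, contract_vc_whisker.
Qed.

Lemma eta_dual2 a b z (X Y : hom1 a b) (f : hom2 X Y) (W : hom1 z b) :
  (Y ◁ (dual2 L f ▷ W)) ∘ eta Y W = (f ▷ (X† ⊗ W)) ∘ eta X W.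
Proof.
rewrite dual2_whisker. apply transposeK.
Qed.

Lemma eps_ev_comp a b c z (Y : hom1 b c) (X : hom1 a b) (W : hom1 z a) :
  contract (ev_comp L Y X) W
  = eps X W ∘ (X† ◁ (eps Y (X ⊗ W) ∘ (Y† ◁ assoc Y X W))) ∘ assoc X† Y† (Y ⊗ X ⊗ W).
Proof.
assert (E : ev_comp L Y X = ev L X ∘ (X† ◁ contract (ev L Y) X) ∘ assoc X† Y† (Y ⊗ X)).
{ unfold ev_comp, contract. now rewrite !whisker_l_vc, ?vcA. }
rewrite E, contract_assoc, contract_vc_whisker, contract_tensor.
rw <- (whisker_l_vc _ _ _). rw (assocVK _ _ _). reflexivity.
Qed.

Lemma dual_tensor_whisker a b c z (Y : hom1 b c) (X : hom1 a b) (W : hom1 z c) :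
  (dual_tensor L Y X ▷ W) ∘ assoc_inv X† Y† W
  = eps X _ ∘ (X† ◁ (eps Y _ ∘ (Y† ◁ (assoc Y X _ ∘ eta (Y ⊗ X) W)))).
Proof.
change (dual_tensor L Y X) with (mate (ev_comp L Y X)).
rewrite mate_whisker, eps_ev_comp.
rw (assoc_whisker_l _ _ _). rw (assocVK _ _ _). rewrite !whisker_l_vc, ?vcA. reflexivity.
Qed.

(** [dual_tensor_whisker] shows [dual_tensor] as a double transpose of [eta (Y ⊗ X)]; [transposeK]
    undoes both transpositions. *)
Lemma eta_tensor a b c z (Y : hom1 b c) (X : hom1 a b) (W : hom1 z c) :
  (Y ⊗ X ◁ ((dual_tensor L Y X ▷ W) ∘ assoc_inv X† Y† W)) ∘ assoc_inv Y X _
    ∘ (Y ◁ eta X _) ∘ eta Y W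
  = eta (Y ⊗ X) W.
Proof.
rewrite dual_tensor_whisker. rw <- (assoc_inv_whisker_l _ _ _).
rw <- (whisker_l_vc _ _ (eta X _)). rewrite transposeK.
rw (transposeK _). rw (assocK _ _ _). reflexivity.
Qed.

Lemma eps_dual_tensor a b c z (Y : hom1 b c) (X : hom1 a b) (W : hom1 z a) :
  eps (Y ⊗ X) W ∘ (dual_tensor L Y X ▷ (Y ⊗ X ⊗ W))
  = eps X W ∘ (X† ◁ (eps Y (X ⊗ W) ∘ (Y† ◁ assoc Y X W))) ∘ assoc X† Y† (Y ⊗ X ⊗ W).
Proof. rewrite <- eps_ev_comp. apply eps_mate. Qed.

Lemma dual_tensor_iso a b c (Y : hom1 b c) (X : hom1 a b) :
  exists g : hom2 (Y ⊗ X)† (X† ⊗ Y†),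
    g ∘ dual_tensor L Y X = id2 _ /\ dual_tensor L Y X ∘ g = id2 _.
Proof.
(* [n] is the unit of the nested adjunction and [s] its transpose along [Y ⊗ X]: the comparison map
   opposite to [dual_tensor], whiskered by the unit. *)
pose (n := assoc_inv Y X _ ∘ (Y ◁ eta X _) ∘ eta Y (id1 c)).
pose (s := assoc_inv X† Y† _ ∘ eps (Y ⊗ X) _ ∘ ((Y ⊗ X)† ◁ n)).
assert (sd : s ∘ (dual_tensor L Y X ▷ _) = id2 _).
{ apply (vc_cancel_r (assocK _ _ _)). unfold s.
  rw <- (whisker_exchange (dual_tensor L Y X) n). rewrite <- (vcA _ (eps _ _)), eps_dual_tensor, ?vcA.
  rw <- (assoc_inv_whisker_l _ _ n). rw (assocVK _ _ _).
  rw <- (whisker_l_vc _ _ (Y† ◁ n)). rw <- (whisker_l_vc _ _ n). unfold n.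
  rewrite ?vcA, assocVK, vc1l, transposeVK. rw (eps_eta _ _). reflexivity. }
assert (ds : (dual_tensor L Y X ▷ _) ∘ s = id2 _).
{ unfold s. rewrite ?vcA. rw <- (eps_nat _ _). rw <- (whisker_l_vc _ _ n). unfold n.
  rewrite ?vcA, eta_tensor. apply eps_eta. }
(* Conjugation by [runit] removes the whiskering by the unit. *)
exists (runit _ ∘ s ∘ runit_inv _). split.
- rewrite <- vcA, <- runit_inv_nat, vcA. rw sd. apply runitVK.
- rewrite ?vcA, <- (runit_nat (bicat_laws B)). rw ds. apply runitVK.
Qed.

End Adjoints.

(** * Quantum dimensions *)

Section Pivotality.
Context {B : Bicat} {L : LeftAdjoints B} (P : Pivotal L).
Implicit Types a b c z : ob B.
Local Notation "X †" := (ldual L X) (at level 1, format "X †").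
Local Notation δ := (delta P).
Local Notation δV := (delta_inv P).
Local Notation eps := (eps L).
Local Notation eta := (eta L).

Definition teps a b z (X : hom1 a b) (W : hom1 z b) : hom2 (X ⊗ (X† ⊗ W)) W :=
  contract (tev P X) W.

Lemma tepsE a b z (X : hom1 a b) (W : hom1 z b) :
  teps X W = eps X† W ∘ (δ X ▷ (X† ⊗ W)).
Proof. apply contract_whisker_vc. Qed.

(** Naturality of [δ] replaces [f] by its double dual, and dinaturality of [eps] moves that to the
    other factor. *)
Lemma teps_dual2 a b z (X Y : hom1 a b) (f : hom2 X Y) (W : hom1 z b) :
  teps Y W ∘ (f ▷ (Y† ⊗ W)) = teps X W ∘ (X ◁ (dual2 L f ▷ W)).
Proof.
rewrite !tepsE. rw <- (whisker_r_vc _ (δ Y) _). rewrite (delta_nat P).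
rw (whisker_r_vc _ _ _). rewrite eps_dual2. rw (whisker_exchange _ _). reflexivity.
Qed.

(** [eps_dual2] trades [dual_tensor] for its dual next to [δ (Y ⊗ X)], where [delta_tensor] applies;
    then the counit of [X† ⊗ Y†] unnests. *)
Lemma teps_tensor a b c z (Y : hom1 b c) (X : hom1 a b) (W : hom1 z c) :
  teps (Y ⊗ X) W ∘ (Y ⊗ X ◁ (dual_tensor L Y X ▷ W))
  = teps Y W ∘ (Y ◁ teps X (Y† ⊗ W)) ∘ assoc Y X _ ∘ (Y ⊗ X ◁ assoc X† Y† W).
Proof.
rewrite !tepsE. rw (whisker_exchange _ _).
rewrite <- eps_dual2. rw <- (whisker_r_vc _ (dual2 _ _) _). rewrite <- (delta_tensor P).
rw (whisker_r_vc _ _ _). rewrite eps_dual_tensor.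
rw (assoc_nat (bicat_laws B) _ _ _). rw (assoc_whisker_l _ _ _).
rewrite (hc2_split (δ Y)), !whisker_l_vc, ?vcA.
rw <- (whisker_exchange (δ Y) _). rw <- (whisker_exchange (δ Y) _).
rw <- (whisker_exchange (δ Y) _).
rw <- (whisker_l_vc _ _ (δ X ▷ _)). rw <- (whisker_exchange (δ X) _).
rw (whisker_l_vc _ (δ X ▷ _) _). reflexivity.
Qed.

Lemma act_Dr a b z (X : hom1 a b) (psi : End1 a) (W : hom1 z b) :
  act (Dr P X psi) W = teps X W ∘ (X ◁ act psi (X† ⊗ W)) ∘ eta X W.
Proof.
unfold Dr. rewrite <- vcA. rewrite act_loop, cocontract_whisker_r, act_whisker_l, ?vcA.
reflexivity.
Qed.

Lemma act_Dl a b z (X : hom1 a b) (phi : End1 b) (W : hom1 z a) :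
  act (Dl P X phi) W
  = eps X W ∘ (X† ◁ act phi (X ⊗ W)) ∘ (X† ◁ (δV X ▷ W)) ∘ eta X† W.
Proof.
unfold Dl, tcoev. rewrite <- ?vcA.
rewrite act_loop, !cocontract_whisker_l, ?vcA.
change (lunit X ∘ (phi ▷ X) ∘ lunit_inv X) with (act phi X). rewrite act_tensor.
reflexivity.
Qed.

Lemma Dr_tensor a b c (Y : hom1 b c) (X : hom1 a b) (psi : End1 a) :
  Dr P (Y ⊗ X) psi = Dr P Y (Dr P X psi).
Proof.
apply act_inj. intros W. rewrite !act_Dr, <- eta_tensor, ?vcA.
(* Naturality of [act] carries [dual_tensor] from the unit to the pairing, where [teps_tensor]
   resolves it. *)
rw <- (whisker_l_vc (Y ⊗ X) (act psi _) _). rewrite act_nat. rw (act_nat _ (assoc_inv _ _ _)).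
rw (whisker_l_vc _ _ _).
rw (whisker_l_vc _ (_ ▷ W) _). rewrite teps_tensor.
rw <- (whisker_l_vc _ (assoc _ _ _) (assoc_inv _ _ _)). rw (assocVK _ _ _).
rw (assoc_whisker_l _ _ _). rw (assocVK _ _ _). rewrite !whisker_l_vc, ?vcA. reflexivity.
Qed.

(** The dual of [f] slides around the loop from the pairing to the unit and becomes [f] there, where
    it cancels against [g]. *)
Lemma Dr_iso a b (X Y : hom1 a b) (f : hom2 X Y) (g : hom2 Y X) (psi : End1 a) :
  g ∘ f = id2 X -> f ∘ g = id2 Y -> Dr P X psi = Dr P Y psi.
Proof.
intros gf fg. apply act_inj. intros W. rewrite !act_Dr.
assert (E : teps Y W = teps X W ∘ (X ◁ (dual2 L f ▷ W)) ∘ (g ▷ (Y† ⊗ W))).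
{ rewrite <- teps_dual2. rw <- (whisker_r_vc _ f g). now rewrite fg, hc2_11, vc1r. }
rewrite E. rw (whisker_exchange g _). rw <- (whisker_l_vc _ (_ ▷ W) _).
rewrite <- act_nat. rw (whisker_l_vc _ _ _). rw <- (whisker_exchange g _).
rw (eta_dual2 _ f W). rw <- (whisker_r_vc _ g f). rewrite gf. rewrite hc2_11, vc1r.
reflexivity.
Qed.

Lemma dim_rE a b (X : hom1 a b) : dim_r P X = Dr P X (id2 (id1 a)).
Proof. unfold Dr. rewrite hc2_11, vc1r, runitVK, hc2_11, vc1r. reflexivity. Qed.

Lemma dim_lE a b (X : hom1 a b) : dim_l P X = Dl P X (id2 (id1 b)).
Proof. unfold Dl. rewrite hc2_11, vc1r, lunitVK, hc2_11, vc1r. reflexivity. Qed.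

(** * The right dimension of a unit *)

Lemma whisker_id1_act a b (psi : End1 b) (V : hom1 a b) :
  id1 b ◁ act psi V = act psi (id1 b ⊗ V).
Proof.
apply (vc_cancel_l (lunitK V)). now rewrite (lunit_nat (bicat_laws B)), act_nat.
Qed.

Lemma Dr_id1 a (psi : End1 a) : Dr P (id1 a) psi = psi ∘ dim_r P (id1 a).
Proof.
apply act_inj. intros W. rewrite act_vc, dim_rE, !act_Dr, act_id, hc2_11, vc1r.
rewrite whisker_id1_act, <- act_nat, ?vcA. reflexivity.
Qed.

(** With [lunit_etaVK]: [lunit ∘ eta] is an isomorphism [W ≅ 1† ⊗ W], natural by [lunit_eta_nat]. *)
Lemma lunit_etaK a z (W : hom1 z a) :
  eps (id1 a) W ∘ (_ ◁ lunit_inv W) ∘ (lunit _ ∘ eta (id1 a) W) = id2 W.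
Proof.
rewrite ?vcA. rw <- (lunit_nat (bicat_laws B) (_ ◁ lunit_inv W)). rw (eta_nat _ _ _).
rw <- (lunit_nat (bicat_laws B) (eps _ _)). rw (eta_eps _ _ _). apply lunitVK.
Qed.

Lemma lunit_eta_nat a z (V W : hom1 z a) (f : hom2 V W) :
  ((id1 a)† ◁ f) ∘ (lunit _ ∘ eta (id1 a) V) = lunit _ ∘ eta (id1 a) W ∘ f.
Proof. rewrite ?vcA. rw <- (lunit_nat (bicat_laws B) _). rw (eta_nat _ _ _). reflexivity. Qed.

Lemma lunit_etaVK a z (W : hom1 z a) :
  lunit _ ∘ eta (id1 a) W ∘ (eps (id1 a) W ∘ (_ ◁ lunit_inv W)) = id2 _.
Proof.
rewrite vcA, <- eps_nat. rw <- (whisker_l_vc _ _ (lunit_inv W)).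
rewrite lunit_inv_nat, ?vcA, lunitK, vc1l. apply eps_eta.
Qed.

Lemma ldual_id1_iso a :
  exists (f : hom2 (id1 a) (id1 a)†) (g : hom2 (id1 a)† (id1 a)),
    g ∘ f = id2 _ /\ f ∘ g = id2 _.
Proof.
exists (runit _ ∘ (lunit _ ∘ eta (id1 a) (id1 a))),
  (eps (id1 a) (id1 a) ∘ (_ ◁ lunit_inv _) ∘ runit_inv _).
split.
- rewrite ?vcA. rw (runitK _). rewrite <- (lunit_etaK (id1 a)), ?vcA. reflexivity.
- pose proof (lunit_etaVK (id1 a)) as E. rewrite ?vcA in E. rewrite ?vcA. rw E.
  apply runitVK.
Qed.

Lemma dim_r_id1 a : dim_r P (id1 a) = id2 (id1 a).
Proof.
(* [k] is idempotent and acts as [t ∘ u], where both [u] and [t] (by [v]) have left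
   inverses; hence it is the identity. *)
set (k := dim_r P (id1 a)).
assert (kk : k ∘ k = k).
{ rewrite <- Dr_id1. unfold k. rewrite !dim_rE, <- Dr_tensor.
  symmetry. apply (Dr_iso _ (lunitVK (id1 a)) (lunitK (id1 a))). }
apply act_inj. intros W.
assert (kE : act k W = teps (id1 a) W ∘ eta (id1 a) W).
{ unfold k. now rewrite dim_rE, act_Dr, act_id, hc2_11, vc1r. }
pose (u := fun V : hom1 a a => lunit _ ∘ eta (id1 a) V).
pose (t := teps (id1 a) W ∘ lunit_inv _).
pose (v := fun V : hom1 a a => ((id1 a)† ◁ (lunit V ∘ (δV (id1 a) ▷ V))) ∘ eta (id1 a)† V).
assert (vn : forall V V' (f : hom2 V V'), ((id1 a)† ◁ f) ∘ v V = v V' ∘ f).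
{ intros V V' f. unfold v. rewrite <- vcA, <- eta_nat, ?vcA, <- !whisker_l_vc, ?vcA.
  rw (whisker_exchange _ _). now rewrite <- (lunit_nat (bicat_laws B)). }
(* Naturality of [v] moves it in front of [t]; there [δV] cancels the [δ] inside [teps], leaving a
   triangle identity for [1†]. *)
assert (vt : v W ∘ t = id2 _).
{ transitivity (((id1 a)† ◁ t) ∘ v ((id1 a)† ⊗ W)); [| unfold v, t].
  - symmetry. apply vn.
  - rewrite ?vcA. rw <- (whisker_l_vc _ (_ ∘ _) _). rw (lunitK _). rewrite tepsE.
    rw <- (whisker_r_vc _ (δ _) _). rewrite (delta_inv_r P). rewrite hc2_11, vc1r. apply eta_eps. }
assert (tu : t ∘ u W = act k W).
{ rewrite kE. unfold t, u. rewrite ?vcA. rw (lunitK _). reflexivity. }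
assert (utu : u W ∘ (t ∘ u W) = u W).
{ rewrite <- (vc1l (u W ∘ _)), <- vt, <- (vcA (v W)), (vcA t), tu, <- act_vc, kk, <- tu, vcA, vt.
  apply vc1l. }
rewrite <- tu, act_id, <- (vc1l (t ∘ u W)), <- (lunit_etaK W), <- vcA.
apply f_equal. exact utu.
Qed.

Lemma Dr_id1_id a (psi : End1 a) : Dr P (id1 a) psi = psi.
Proof. now rewrite Dr_id1, dim_r_id1, vc1r. Qed.

(** * Comparison of left and right dimensions *)

Lemma eps_lunit_eta a z (W : hom1 z a) :
  eps (id1 a) W ∘ (lunit _ ∘ eta (id1 a) (id1 a ⊗ W)) = lunit W.
Proof.
rewrite vcA, <- (lunit_nat (bicat_laws B)). rw (eta_eps _ _ _). reflexivity.
Qed.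

(** This is where [dim_r 1 = 1] enters: it makes [teps ∘ eta] the identity for the unit. *)
Lemma teps_lunit_eta a z (W : hom1 z a) :
  teps (id1 a) W ∘ (id1 a ◁ (lunit _ ∘ eta (id1 a) W)) = lunit W.
Proof.
assert (E : teps (id1 a) W ∘ eta (id1 a) W = id2 W).
{ rewrite <- (act_id W), <- (dim_r_id1 a), dim_rE, act_Dr, act_id, hc2_11, vc1r. reflexivity. }
apply (vc_cancel_r (lunitK W)).
rw (lunit_inv_nat _). rw (lunitK _). rewrite E. symmetry. apply lunitVK.
Qed.

(** Both sides reduce to [eta (X† ⊗ X) W] followed by [ev L X] on the first factor. *)
Lemma dual2_ev a b z (X : hom1 a b) (W : hom1 z a) :
  (dual2 L (ev L X) ▷ W) ∘ (lunit _ ∘ eta (id1 a) W)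
  = (dual_tensor L X† X ▷ W) ∘ assoc_inv X† X†† W ∘ eta X† W.
Proof.
rewrite dual_tensor_whisker, dual2_whisker, <- vcA, lunit_eta_nat, vcA, eps_lunit_eta.
rw (transposeK _ _). unfold eps, contract. rw (assocK _ _ _). reflexivity.
Qed.

(* Dinaturality of [teps] along [ev L X], with the unit isomorphism [1 ≅ 1†] inserted on the
   right, turns the dual of [ev L X] into [coev] of [X†]. *)
Lemma teps_ldual a b z (X : hom1 a b) (W : hom1 z a) :
  teps X† W ∘ (X† ◁ (δ X ▷ W)) = eps X W.
Proof.
assert (E : lunit W ∘ (ev L X ▷ W) = teps X† W ∘ (X† ◁ (δ X ▷ W)) ∘ assoc X† X W).
{ rewrite <- teps_lunit_eta, <- vcA, <- whisker_exchange, vcA, teps_dual2, <- vcA.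
  rewrite <- whisker_l_vc, dual2_ev. rw (whisker_l_vc _ _ _). rw (whisker_l_vc _ (_ ▷ W) _).
  rewrite teps_tensor.
  rw <- (whisker_l_vc _ (assoc _ _ _) (assoc_inv _ _ _)). rw (assocVK _ _ _).
  rw (assoc_whisker_l _ _ _). rewrite (tepsE X).
  rw <- (whisker_l_vc _ _ (X ◁ _)). rw (whisker_exchange (δ X) _).
  rewrite eps_eta, vc1l. reflexivity. }
unfold eps, contract. rewrite E. rw (assocVK _ _ _). reflexivity.
Qed.

Lemma Dl_Dr a b (X : hom1 a b) (phi : End1 b) : Dl P X phi = Dr P X† phi.
Proof.
apply act_inj. intros W. rewrite act_Dl, act_Dr, <- teps_ldual.
rw <- (whisker_l_vc _ (δ X ▷ _) _). rewrite <- act_nat. rw (whisker_l_vc _ _ _).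
rw <- (whisker_l_vc _ (δ X ▷ _) _). rw <- (whisker_r_vc _ (δ X) _).
rewrite (delta_inv_r P), !hc2_11, vc1r. reflexivity.
Qed.

(** [δ X] is an isomorphism from [X] to its double dual. *)
Lemma Dl_ldual a b (X : hom1 a b) (psi : End1 a) : Dl P X† psi = Dr P X psi.
Proof.
rewrite Dl_Dr. symmetry. exact (Dr_iso _ (delta_inv_l P X) (delta_inv_r P X)).
Qed.

Lemma Dl_tensor a b c (Y : hom1 b c) (X : hom1 a b) (phi : End1 c) :
  Dl P (Y ⊗ X) phi = Dl P X (Dl P Y phi).
Proof.
destruct (dual_tensor_iso L Y X) as (g & gf & fg).
now rewrite !Dl_Dr, <- (Dr_iso phi gf fg), Dr_tensor.
Qed.

Lemma Dl_id1_id a (phi : End1 a) : Dl P (id1 a) phi = phi.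
Proof.
destruct (ldual_id1_iso a) as (f & g & gf & fg).
now rewrite Dl_Dr, <- (Dr_iso phi gf fg), Dr_id1_id.
Qed.

(** * Stability of quantum dimensions *)

Lemma invertible2_id a b (X : hom1 a b) : invertible2 (id2 X).
Proof. exists (id2 X). now rewrite vc1l. Qed.

Lemma is_qdim_Dr a b (X : hom1 a b) (psi : End1 a) :
  is_qdim P psi -> is_qdim P (Dr P X psi).
Proof.
intros [(c & Z & <-) | (c & Z & <-)]; right.
(* The left dimension of [Z] is the right dimension of [Z†]. *)
- exists c, (X ⊗ Z†). now rewrite dim_rE, dim_lE, Dr_tensor, Dl_Dr.
- exists c, (X ⊗ Z). now rewrite !dim_rE, Dr_tensor.
Qed.

Lemma is_qdim_Dl a b (X : hom1 a b) (phi : End1 b) :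
  is_qdim P phi -> is_qdim P (Dl P X phi).
Proof. rewrite Dl_Dr. apply is_qdim_Dr. Qed.

Lemma is_qdim_dim_r a b (X : hom1 a b) : is_qdim P (dim_r P X).
Proof. right. now exists a, X. Qed.

Lemma is_qdim_dim_l a b (X : hom1 a b) : is_qdim P (dim_l P X).
Proof. left. now exists b, X. Qed.

End Pivotality.

Theorem theorem2p2 (B : Bicat) (L : LeftAdjoints B) (P : Pivotal L) :
  Equivalence (orbifold_equivalent P).
Proof.
split.
- intros a. exists (id1 a). rewrite dim_lE, dim_rE, Dr_id1_id, Dl_id1_id.
  split; [apply invertible2_id |]. split; [apply invertible2_id |].
  split; intros psi Hpsi _; [rewrite Dr_id1_id | rewrite Dl_id1_id]; exact Hpsi.
- intros a b (X & Hl & Hr & Ha & Hb). exists (ldual L X).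
  (* Passing to the dual exchanges [Dl] and [Dr], so the conditions on [X] return in swapped
     order. *)
  rewrite dim_lE, dim_rE, Dl_ldual, <- Dl_Dr, <- dim_lE, <- dim_rE.
  split; [exact Hr |]. split; [exact Hl |].
  split; [intros phi | intros psi]; [rewrite <- Dl_Dr | rewrite Dl_ldual]; auto.
- intros a b c (X & HlX & HrX & HaX & HbX) (Y & HlY & HrY & HaY & HbY). exists (Y ⊗ X).
  rewrite dim_lE, dim_rE, Dr_tensor, Dl_tensor, <- dim_lE, <- dim_rE.
  (* [dim_l (Y ⊗ X)] is [Dl X] at [dim_l Y], an invertible quantum dimension, so condition (ii) for
     [X] applies. *)
  split; [apply HbX; [exact HlY | apply is_qdim_dim_l] |].
  split; [apply HaY; [exact HrX | apply is_qdim_dim_r] |].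
  split; [intros psi Hpsi Qpsi | intros phi Hphi Qphi].
  (* Condition (ii) for [Y] applies because [Dr X psi] is again an invertible quantum dimension. *)
  + rewrite Dr_tensor. apply HaY; [| apply is_qdim_Dr]; auto.
  + rewrite Dl_tensor. apply HbX; [| apply is_qdim_Dl]; auto.
Qed.
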